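(* Let $L=\{E\}$ be the language of (finite, undirected, loopless) graphs. For each $k\geq 1$, let $\phi_k(x)$ be the first-order property ''$x$ is adjacent to exactly $k$ nodes''. Then $d(\phi_k:\mathrm{typ})=0$.
   Context: $L$-structures are graphs $G=\langle A,E\rangle$ with $E$ a symmetric irreflexive binary relation on $A$; $\mathbf{S}_n(L)$ is the set of all such graphs with node set $\{1,\ldots,n\}$, so $|\mathbf{S}_n(L)|=2^{\binom{n}{2}}$. For a first-order formula $\phi(x)$ of $L$ with one free variable and a graph $G$ with node set $A$, $\phi(G)=\{a\in A:G\models\phi(a)\}$. Let $\mathbf{S}_n(\phi:\mathrm{typ})=\{G\in\mathbf{S}_n(L):|\phi(G)|>n/2\}$, $d_n(\phi:\mathrm{typ})=|\mathbf{S}_n(\phi:\mathrm{typ})|/|\mathbf{S}_n(L)|$, and $d(\phi:\mathrm{typ})=\lim_{n\to\infty}d_n(\phi:\mathrm{typ})$ whenever this limit exists. *)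

(* Defs.v *)
From HB Require Import structures.
From mathcomp Require Import all_boot all_order all_algebra.
From mathcomp Require Import all_classical all_reals all_analysis.
Import numFieldNormedType.Exports.

Set Implicit Arguments.
Unset Strict Implicit.
Unset Printing Implicit Defensive.

Import Order.TTheory GRing.Theory Num.Theory.

Local Open Scope nat_scope.

Definition graph_relb (A : finType) (E : {set A * A}) : bool :=
  [forall a, (a, a) \notin E] &&
  [forall a, forall b, ((a, b) \in E) == ((b, a) \in E)].

Record graph (A : finType) := Graph {
  edges : {set A * A};
  _ : graph_relb edges
}.

HB.instance Definition _ (A : finType) := [isSub for @edges A].
HB.instance Definition _ (A : finType) := [Finite of graph A by <:].

Definition adj (A : finType) (G : graph A) : rel A :=
  fun a b => (a, b) \in edges G.

(* First-order formulas over {E} with equality whose free variables are among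
   x_0, ..., x_(m-1).  Quantifiers bind the last variable x_m of their body,
   so that x_0, ..., x_(m-1) keep their names under a quantifier. *)
Inductive formula : nat -> Type :=
| FTrue m : formula m
| FFalse m : formula m
| FEq m (i j : 'I_m) : formula m
| FAdj m (i j : 'I_m) : formula m
| FNot m (f : formula m) : formula m
| FAnd m (f g : formula m) : formula m
| FOr m (f g : formula m) : formula m
| FImp m (f g : formula m) : formula m
| FAll m (f : formula m.+1) : formula m
| FEx m (f : formula m.+1) : formula m.

Arguments FTrue {m}.
Arguments FFalse {m}.

Definition extend (A : Type) m (v : 'I_m -> A) (a : A) : 'I_m.+1 -> A :=
  fun i => if unlift ord_max i is Some j then v j else a.

Fixpoint sat (A : finType) (G : graph A) m (f : formula m) :
    ('I_m -> A) -> bool :=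
  match f in formula m return ('I_m -> A) -> bool with
  | FTrue _ => fun _ => true
  | FFalse _ => fun _ => false
  | FEq _ i j => fun v => v i == v j
  | FAdj _ i j => fun v => adj G (v i) (v j)
  | FNot _ f => fun v => ~~ sat G f v
  | FAnd _ f g => fun v => sat G f v && sat G g v
  | FOr _ f g => fun v => sat G f v || sat G g v
  | FImp _ f g => fun v => sat G f v ==> sat G g v
  | FAll _ f => fun v => [forall a, sat G f (extend v a)]
  | FEx _ f => fun v => [exists a, sat G f (extend v a)]
  end.

Definition FAnds m (s : seq (formula m)) : formula m := foldr (@FAnd m) FTrue s.
Definition FOrs m (s : seq (formula m)) : formula m := foldr (@FOr m) FFalse s.

Fixpoint FExs k : formula k.+1 -> formula 1 :=
  match k with
  | 0 => id
  | k'.+1 => fun f => FExs (FEx f)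
  end.

(* phi_k(x) is
     exists y_1 ... y_k, /\_(i < j) y_i != y_j /\ /\_i E(x, y_i)
       /\ forall z, E(x, z) -> \/_i z = y_i,
   where x = x_0, y_i = x_i for 1 <= i <= k, and z = x_(k+1). *)
Definition distinct_ys k : formula k.+1 :=
  FAnds [seq FNot (FEq (lift ord0 p.1) (lift ord0 p.2))
        | p <- enum [pred p : 'I_k * 'I_k | p.1 < p.2]].

Definition adjacent_ys k : formula k.+1 :=
  FAnds [seq FAdj ord0 (lift ord0 i) | i : 'I_k].

Definition only_ys k : formula k.+1 :=
  FAll (FImp (FAdj ord0 ord_max)
    (FOrs [seq FEq ord_max (lift ord_max (lift ord0 i)) | i : 'I_k])).

Definition exact_degree (k : nat) : formula 1 :=
  FExs (FAnd (distinct_ys k) (FAnd (adjacent_ys k) (only_ys k))).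

Lemma sat_FAnds (A : finType) (G : graph A) m (s : seq (formula m)) v :
  sat G (FAnds s) v = all (fun f => sat G f v) s.
Proof. by elim: s => //= f s ->. Qed.

Lemma sat_FOrs (A : finType) (G : graph A) m (s : seq (formula m)) v :
  sat G (FOrs s) v = has (fun f => sat G f v) s.
Proof. by elim: s => //= f s ->. Qed.

Lemma sat_FExs (A : finType) (G : graph A) k (f : formula k.+1) (a : A) :
  sat G (FExs f) (fun=> a) <->
  exists2 v : 'I_k.+1 -> A, v ord0 = a & sat G f v.
Proof.
elim: k f => [|k IH] f /=.
  split=> [fa|[v va]]; first by exists (fun=> a).
  suff -> : v = (fun=> a) by [].
  by apply: funext => i; rewrite ord1.
split=> [/IH[v va /existsP[b vb]]|[v va vf]].
  exists (extend v b) => //; rewrite /extend.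
  have {1}-> : ord0 = lift ord_max (ord0 : 'I_k.+1) by apply: val_inj.
  by rewrite liftK.
apply/IH; exists (fun i => v (lift ord_max i)).
  by rewrite -va; congr v; apply: val_inj.
apply/existsP; exists (v ord_max).
suff -> : extend (fun i => v (lift ord_max i)) (v ord_max) = v by [].
by apply: funext => i; rewrite /extend; case: unliftP => [j ->|->].
Qed.

Lemma sat_exact_degree (A : finType) (G : graph A) (k : nat) (a : A) :
  sat G (exact_degree k) (fun=> a) = (#|[set b | adj G a b]| == k).
Proof.
pose core := FAnd (distinct_ys k) (FAnd (adjacent_ys k) (only_ys k)).
have coreP (v : 'I_k.+1 -> A) (y := fun i => v (lift ord0 i)) :
    sat G core v <-> injective y /\
      [set b | adj G (v ord0) b] = [set y i | i : 'I_k].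
  have extL i b : extend v b (lift ord_max i) = v i by rewrite /extend liftK.
  have ext0 b : extend v b ord0 = v ord0.
    by rewrite -(extL _ b); congr (extend v b); apply: val_inj.
  have extM b : extend v b ord_max = b by rewrite /extend unlift_none.
  have -> : sat G core v = [&& sat G (distinct_ys k) v,
      sat G (adjacent_ys k) v & sat G (only_ys k) v] by [].
  have d : reflect (injective y) (sat G (distinct_ys k) v).
    rewrite sat_FAnds all_map; apply: (iffP allP) => [H i j yij|yI [i j]].
      apply/val_inj; apply/eqP; apply: contraT; rewrite neq_ltn.
      case/orP=> lij; [move: (H (i, j)) | move: (H (j, i))];
        by rewrite mem_enum inE /= -/(y i) -/(y j) yij eqxx => /(_ lij).
    rewrite mem_enum inE /= => lij; apply/negP => /eqP/yI eij.
    by rewrite eij ltnn in lij.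
  have e : reflect (forall i, adj G (v ord0) (y i)) (sat G (adjacent_ys k) v).
    rewrite sat_FAnds all_map; apply: (iffP allP) => [H i|H i _]; last exact: H.
    by apply: H; rewrite mem_enum.
  have o : reflect (forall b, adj G (v ord0) b -> exists i, b = y i)
                   (sat G (only_ys k) v).
    have -> : sat G (only_ys k) v = [forall b,
        adj G (extend v b ord0) (extend v b ord_max) ==>
        sat G (FOrs [seq FEq ord_max (lift ord_max (lift ord0 i)) | i : 'I_k])
          (extend v b)] by [].
    apply: (iffP forallP) => H b.
      move=> ab; move: (H b); rewrite ext0 extM ab sat_FOrs has_map /=.
      by case/hasP=> i _ /=; rewrite extM extL => /eqP ->; exists i.
    apply/implyP; rewrite ext0 extM => /H[i bE].
    rewrite sat_FOrs has_map; apply/hasP; exists i; first by rewrite mem_enum.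
    by rewrite /= extM extL bE.
  split=> [/and3P[/d yI /e ya /o yo]|[yI yE]].
    split=> //; apply/setP => b; rewrite inE; apply/idP/imsetP => [/yo[i ->]|].
      by exists i.
    by case=> i _ ->.
  apply/and3P; split; [exact/d|apply/e => i|apply/o => b].
    by have /setP/(_ (y i)) := yE; rewrite inE => ->; apply: imset_f.
  by move: yE => /setP/(_ b); rewrite inE => -> /imsetP[i _ ->]; exists i.
apply/idP/eqP => [/sat_FExs[v <- /coreP[yI ->]]|cE].
  by rewrite card_imset // card_ord.
apply/sat_FExs.
set N := [set b | adj G a b] in cE.
pose y (i : 'I_k) := enum_val (cast_ord (esym cE) i).
exists (fun i => if unlift ord0 i is Some j then y j else a).
  by rewrite unlift_none.
apply/coreP; rewrite unlift_none.
have -> : (fun i : 'I_k => if unlift ord0 (lift ord0 i) is Some j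
            then y j else a) = y by apply: funext => i; rewrite liftK.
have yI : injective y by move=> i j /enum_val_inj/cast_ord_inj.
split=> //; apply/esym/eqP; rewrite eqEcard card_imset // card_ord cE leqnn andbT.
by apply/fintype.subsetP => _ /imsetP[i _ ->]; apply: enum_valP.
Qed.

Definition solutions (A : finType) (G : graph A) (phi : formula 1) : {set A} :=
  [set a | sat G phi (fun=> a)].

(* |phi(G)| > n/2, with the denominator cleared *)
Definition typ_graphs (phi : formula 1) (n : nat) : {set graph 'I_n} :=
  [set G | n < 2 * #|solutions G phi|].

Definition typ_density (R : realType) (phi : formula 1) (n : nat) : R :=
  (#|typ_graphs phi n|%:R / #|{: graph 'I_n}|%:R)%R.

(* Main.v *)
(* Adding an edge at a fixed vertex a maps the pairs (G, b), where a has degree k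
   in G and b is a non-neighbour of a, injectively into the pairs (H, b), where a
   has degree k + 1 in H and b is a neighbour of a.  Hence a has degree k in at
   most a fraction (k + 1) / (n - (k + 1)) of all graphs, and by Markov's
   inequality at most twice this fraction of all graphs have more than n / 2
   vertices of degree k. *)
Require Import Defs.
From mathcomp Require Import all_boot all_order all_algebra.
From mathcomp Require Import all_classical all_reals all_analysis.
Import numFieldNormedType.Exports.

Set Implicit Arguments.
Unset Strict Implicit.
Unset Printing Implicit Defensive.

Import Order.TTheory GRing.Theory Num.Theory.

Local Open Scope nat_scope.

Definition neighbors (A : finType) (G : graph A) (a : A) : {set A} :=
  [set b | adj G a b].

Definition degree_graphs (A : finType) (a : A) (k : nat) : {set graph A} :=
  [set G | #|neighbors G a| == k].

Lemma adj_irr (A : finType) (G : graph A) : irreflexive (adj G).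
Proof.
case: G => E EP a; rewrite /adj /=; apply: negbTE.
by have /andP[/forallP/(_ a)] := EP.
Qed.

Lemma adj_sym (A : finType) (G : graph A) : symmetric (adj G).
Proof.
case: G => E EP a b; rewrite /adj /=.
by have /andP[_ /forallP/(_ a)/forallP/(_ b)/eqP] := EP.
Qed.

Lemma graph_eqP (A : finType) (G H : graph A) : adj G =2 adj H -> G = H.
Proof. by move=> GH; apply/val_inj/setP => -[a b]; apply: GH. Qed.

(* Equal to [G] itself when [a = b]. *)
Definition add_edge (A : finType) (a b : A) (G : graph A) : graph A :=
  insubd G ((a, b) |: ((b, a) |: edges G)).

Lemma adj_add_edge (A : finType) (a b : A) (G : graph A) : a != b ->
  forall x y, adj (add_edge a b G) x y =
    [|| (x, y) == (a, b), (x, y) == (b, a) | adj G x y].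
Proof.
move=> ab x y; rewrite /adj /add_edge val_insubd ifT ?inE //.
(* The new edge set is loopless because [a != b], and symmetric because swapping coordinates
   exchanges the two added pairs. Hence [insubd] does not fall back to [G]. *)
apply/andP; split; apply/forallP => u.
  rewrite !inE !xpair_eqE -/(adj G u u) adj_irr orbF.
  by apply/norP; split; apply: contra ab => /andP[/eqP<- /eqP<-].
apply/forallP => v; rewrite !inE !xpair_eqE -/(adj G u v) -/(adj G v u) adj_sym.
by rewrite orbCA ![(v == _) && _]andbC.
Qed.

Lemma neighbors_add_edge (A : finType) (a b : A) (G : graph A) : a != b ->
  neighbors (add_edge a b G) a = b |: neighbors G a.
Proof.
move=> ab; apply/setP => y; rewrite !inE adj_add_edge // !xpair_eqE eqxx.
by rewrite (negbTE ab).
Qed.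

(** Away from the pair [a], [b] nothing changes, and on that pair both graphs are known to have no
    edge. *)
Lemma add_edge_inj (A : finType) (a b : A) (G H : graph A) : a != b ->
  ~~ adj G a b -> ~~ adj H a b -> add_edge a b G = add_edge a b H -> G = H.
Proof.
move=> ab nG nH GH; apply: graph_eqP => x y.
have := congr1 (fun K => adj K x y) GH; rewrite /= !adj_add_edge //.
case: eqP => [[-> ->] _|_ /=]; first by rewrite (negbTE nG) (negbTE nH).
case: eqP => [[-> ->] _|_ //=].
by rewrite ![adj _ b a]adj_sym (negbTE nG) (negbTE nH).
Qed.

Lemma leq_card_degree_graphs (A : finType) (a : A) (k : nat) :
  #|degree_graphs a k| * (#|A| - k.+1) <= #|degree_graphs a k.+1| * k.+1.
Proof.
pose P (p : graph A * A) :=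
  (p.1 \in degree_graphs a k) && (p.2 \notin a |: neighbors p.1 a).
pose Q (p : graph A * A) :=
  (p.1 \in degree_graphs a k.+1) && (p.2 \in neighbors p.1 a).
(* As [a] is not its own neighbour, a vertex [a] of degree [k] leaves [#|A| - k.+1] choices for
   [b]. *)
have cP : #|degree_graphs a k| * (#|A| - k.+1) = #|[set p | P p]|.
  rewrite -sum1dep_card.
  rewrite -(pair_big_dep (mem (degree_graphs a k))
    (fun G b => b \notin a |: neighbors G a) (fun _ _ => 1)) /=.
  rewrite -sum_nat_const; apply: eq_bigr => G; rewrite inE => /eqP dG.
  rewrite sum1dep_card -(cardsC (a |: neighbors G a)) cardsU1 dG inE adj_irr /=.
  by rewrite add1n addKn; apply: eq_card => b; rewrite !inE.
have cQ : #|[set p | Q p]| = #|degree_graphs a k.+1| * k.+1.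
  rewrite -sum1dep_card.
  rewrite -(pair_big_dep (mem (degree_graphs a k.+1))
    (fun G b => b \in neighbors G a) (fun _ _ => 1)) /=.
  rewrite -sum_nat_const; apply: eq_bigr => G; rewrite inE => /eqP dG.
  by rewrite sum1dep_card -dG; apply: eq_card => b; rewrite !inE.
have PE p : P p -> [/\ #|neighbors p.1 a| = k, a != p.2 & ~~ adj p.1 a p.2].
  by rewrite /P !inE [_.2 == a]eq_sym => /andP[/eqP dG /norP[ab nG]].
(* Keeping [b] in the image records which edge was added, so [f] is injective on [P]. *)
pose f (p : graph A * A) := (add_edge a p.2 p.1, p.2).
rewrite cP -cQ -(card_in_imset (f := f)); last first.
  move=> [G b] [H c]; rewrite !inE => /PE[/= _ ab nG] /PE[/= _ _ nH].
  by case=> GH bc; rewrite -bc in GH nH *; rewrite (add_edge_inj ab nG nH GH).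
apply: subset_leq_card; apply/fintype.subsetP => p /imsetP[[G b]].
rewrite inE => /PE[/= dG ab nG] ->.
rewrite !inE /Q /f /= !inE neighbors_add_edge // cardsU1 dG inE nG eqxx /=.
by rewrite adj_add_edge // eqxx.
Qed.

Lemma leq_card_typ_graphs (k n : nat) :
  (n - k.+1) * #|typ_graphs (exact_degree k) n| <=
    2 * k.+1 * #|{: graph 'I_n}|.
Proof.
case: n => [|m]; first by rewrite mul0n.
set n := m.+1; set T := typ_graphs _ _.
have solE (G : graph 'I_n) :
    #|solutions G (exact_degree k)| = \sum_(a | G \in degree_graphs a k) 1.
  rewrite sum1dep_card; apply: eq_card => a.
  by rewrite !inE sat_exact_degree.
(* Markov's inequality: count the pairs of a graph and a vertex of degree [k] in it, first by graph,
   then by vertex. *)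
have markov : #|T| * n <= 2 * \sum_(a : 'I_n) #|degree_graphs a k|.
  rewrite -sum_nat_const.
  apply: (@leq_trans (\sum_(G in T) 2 * #|solutions G (exact_degree k)|)).
    by apply: leq_sum => G; rewrite inE => /ltnW.
  rewrite -big_distrr leq_mul2l /=.
  apply: (@leq_trans (\sum_(G : graph 'I_n) #|solutions G (exact_degree k)|)).
    by rewrite [leqRHS](bigID (mem T)) leq_addr.
  rewrite (eq_bigr _ (fun G _ => solE G)).
  rewrite (exchange_big_dep xpredT) //=; apply: leq_sum => a _.
  by rewrite sum1dep_card cardsE.
(* The extra factor [n], positive since the case [n = 0] is settled, makes [markov] applicable; it
   returns as the number of vertices [a] in the final sum. *)
rewrite -(leq_pmul2r (ltn0Sn m)) -/n -mulnA.
apply: leq_trans (leq_mul (leqnn _) markov) _.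
rewrite mulnCA -!mulnA leq_mul2l /= mulnC big_distrl /=.
apply: (@leq_trans (\sum_(a : 'I_n) k.+1 * #|{: graph 'I_n}|)).
  (* The graphs in which [a] has degree [k.+1] are bounded crudely by all graphs. *)
  apply: leq_sum => a _; have := leq_card_degree_graphs a k.
  rewrite card_ord => /leq_trans; apply.
  by rewrite mulnC leq_mul2l max_card orbT.
by rewrite sum_nat_const card_ord mulnC -mulnA.
Qed.

(** The shift by [k.+2] turns the factor [n - k.+1] of the counting bound into [n.+1], the
    denominator of [harmonic n]. *)
Lemma typ_density_le_harmonic (R : realType) (k n : nat) :
  (typ_density R (exact_degree k) (n + k.+2) <=
     (2 * k.+1)%:R * harmonic n)%R.
Proof.
(* The edgeless graph shows that the denominator of the density is nonzero. *)
have gt0 : 0 < #|{: graph 'I_(n + k.+2)}|.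
  have g0 : graph_relb (finset.set0 : {set 'I_(n + k.+2) * 'I_(n + k.+2)}).
    by apply/andP; split; apply/forallP => a; [|apply/forallP => b]; rewrite !inE.
  by apply/card_gt0P; exists (Graph g0).
rewrite /typ_density /harmonic ler_pdivrMr ?ltr0n // mulrAC ler_pdivlMr ?ltr0n //.
rewrite -!natrM ler_nat mulnC.
apply: leq_trans (leq_card_typ_graphs k (n + k.+2)).
by rewrite -addSnnS addnK.
Qed.

Theorem proposition6p2 (R : realType) (k : nat) (hk : (1 <= k)%N) :
  (typ_density R (exact_degree k) n @[n --> \oo] --> (0%R : R))%classic.
Proof.
rewrite -(cvg_shiftn k.+2).
apply: (squeeze_cvgr (f := fun=> 0%R)
  (h := fun n => ((2 * k.+1)%:R * harmonic n)%R)).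
- apply: nearW => n; rewrite typ_density_le_harmonic andbT.
  by rewrite /typ_density divr_ge0 ?ler0n.
- exact: cvg_cst.
- rewrite -(mulr0 (2 * k.+1)%:R%R); apply: cvgM; first exact: cvg_cst.
  exact: cvg_harmonic.
Qed.
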